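(* Let $\mathfrak{A}$ be a commutative fusion ring/algebra with basis $\{x_1=1,\dots,x_r\}$ and character table $\Lambda=(\lambda_{i,j})_{1\le i,j\le r}$. The Schur product property holds on the dual of $\mathfrak{A}$ if and only if for all triples $(j_1,j_2,j_3)$, $$\sum_{i=1}^r\frac{\lambda_{i,j_1}\lambda_{i,j_2}\lambda_{i,j_3}}{\lambda_{i,1}}\ge0.$$
   Context: Here a fusion algebra $\mathfrak{A}$ means a unital $*$-algebra $\mathcal{B}$ over $\mathbb{C}$ with a basis $\{x_1=1,\dots,x_r\}$ such that $x_jx_k=\sum_sN_{j,k}^sx_s$ with $N_{j,k}^s\in\mathbb{R}_{\ge0}$, and there is an involution $*$ of $\{1,\dots,r\}$ with $x_k^*=x_{k^*}$ and $N_{j,k}^1=\delta_{j,k^*}$; a fusion ring is the case of integer coefficients $N_{j,k}^s\in\mathbb{Z}_{\ge0}$ (then $\mathcal{B}$ is its complexification). $\mathcal{B}$ has the faithful tracial state $\tau(x_j)=\delta_{j,1}$ and is a $C^*$-algebra via left multiplication on $L^2(\mathcal{B},\tau)$; $d$ is the linear functional with $d(x_j)$ equal to the operator norm of left multiplication by $x_j$. Character table: when $\mathfrak{A}$ is commutative, the fusion matrices $M_i=(N_{i,j}^k)_{k,j}$ are normal and commute, so there is an invertible $P$ with $P^{-1}M_iP=\mathrm{diag}(\lambda_{i,1},\dots,\lambda_{i,r})$ for all $i$; the maps $x_i\mapsto\lambda_{i,j}$ ($1\le j\le r$) are the irreducible complex representations (characters) of $\mathfrak{A}$, ordered so that the first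 is $d$, i.e. $\lambda_{i,1}=d(x_i)=\|M_i\|$. The matrix $\Lambda=(\lambda_{i,j})$ is the character table. Schur product property on the dual: let $\mathcal{A}$ be the commutative $C^*$-algebra with the same linear basis, multiplication $x_j\diamond x_k=\delta_{j,k}d(x_j)^{-1}x_j$ and anti-linear involution $x_j^\#=x_j$, let $\mathfrak{F}:\mathcal{A}\to\mathcal{B}$ be linear with $\mathfrak{F}(x_j)=x_j$, and put $x*_{\mathcal{B}}y:=\big(\mathfrak{F}(\mathfrak{F}^{-1}(y^* )\diamond\mathfrak{F}^{-1}(x^* ))\big)^*$. The property holds if $x*_{\mathcal{B}}y\ge0$ for all $x,y\ge0$ in the $C^*$-algebra $\mathcal{B}$. *)

(* Defs.v *)
From mathcomp Require Import all_boot all_order all_algebra all_field.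
From mathcomp Require Import complex.
From mathcomp Require Import classical_sets reals.

Set Implicit Arguments.
Unset Strict Implicit.
Unset Printing Implicit Defensive.

Import Order.TTheory GRing.Theory Num.Theory.

Local Open Scope ring_scope.
Local Open Scope complex_scope.

(* A fusion algebra of rank n.+1.  Indices are 0-based, so [ord0 : 'I_n.+1]
   is the index of the unit.  A fusion ring is the special case where all the
   [fa_N A j k s] are natural numbers. *)
Record fusion_algebra (R : realType) (n : nat) := FusionAlgebra {
  fa_alg :> falgType R[i];
  fa_star : fa_alg -> fa_alg;
  fa_basis : n.+1.-tuple fa_alg;
  fa_N : 'I_n.+1 -> 'I_n.+1 -> 'I_n.+1 -> R;
  fa_dual : 'I_n.+1 -> 'I_n.+1;
  fa_star_antilinear : forall (c : R[i]) (a b : fa_alg),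
    fa_star (c *: a + b) = c^* *: fa_star a + fa_star b;
  fa_starM : forall a b : fa_alg, fa_star (a * b) = fa_star b * fa_star a;
  fa_starK : involutive fa_star;
  fa_basisP : basis_of fullv fa_basis;
  fa_basis1 : fa_basis`_(ord0 : 'I_n.+1) = 1;
  fa_N_ge0 : forall j k s, 0 <= fa_N j k s;
  fa_basisM : forall j k : 'I_n.+1,
    fa_basis`_j * fa_basis`_k = \sum_s (fa_N j k s)%:C *: fa_basis`_s;
  fa_dualK : involutive fa_dual;
  fa_star_basis : forall k : 'I_n.+1, fa_star fa_basis`_k = fa_basis`_(fa_dual k);
  fa_N_unit : forall j k, fa_N j k ord0 = (j == fa_dual k)%:R
}.

Section FusionAlgebra.
Variables (R : realType) (n : nat) (B : fusion_algebra R n).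

Local Notation x := (fa_basis B).
Local Notation "a ^star" := (fa_star a) (at level 2, format "a ^star").

Definition fa_trace (a : B) : R[i] := coord x ord0 a.

(* The norm of L^2(B, tau); tau(a^* a) is a nonnegative real number, so taking
   its real part only changes its type. *)
Definition L2norm (a : B) : R := Num.sqrt (complex.Re (fa_trace (a^star * a))).

(* The operator norm of left multiplication by [a] on L^2(B, tau). *)
Definition opnorm (a : B) : R :=
  sup [set L2norm (a * v) | v in [set v : B | L2norm v <= 1]]%classic.

Definition fa_d (a : B) : R[i] :=
  \sum_(j < n.+1) coord x j a * (opnorm x`_j)%:C.

Definition fa_ge0 (a : B) : Prop := exists b : B, a = b^star * b.

Definition fa_commutative : Prop := forall a b : B, a * b = b * a.

(* Entry (k, j) is N_{i,j}^k: this is the matrix of left multiplication by the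
   i-th basis element, acting on column vectors. *)
Definition fusion_mx (i : 'I_n.+1) : 'M[R[i]]_n.+1 :=
  \matrix_(k, j) (fa_N B i j k)%:C.

Definition is_character_table (Lambda : 'M[R[i]]_n.+1) : Prop :=
  (exists2 P : 'M[R[i]]_n.+1, P \in unitmx &
     forall i, invmx P *m fusion_mx i *m P = diag_mx (row i Lambda))
  /\ (forall i : 'I_n.+1, Lambda i ord0 = fa_d x`_i).

(* The dual algebra A lives on 'rV[R[i]]_n.+1, the j-th basis vector of A being
   [delta_mx 0 j]; its product is the bilinear extension of
   x_j <> x_k = delta_{j,k} d(x_j)^-1 x_j. *)
Definition diamond (u v : 'rV[R[i]]_n.+1) : 'rV[R[i]]_n.+1 :=
  \sum_j \sum_k (u 0 j * v 0 k) *: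
    (((j == k)%:R * (fa_d x`_j)^-1) *: delta_mx 0 j).

Definition Fourier (u : 'rV[R[i]]_n.+1) : B := \sum_j u 0 j *: x`_j.

Definition Fourier_inv (a : B) : 'rV[R[i]]_n.+1 := \row_j coord x j a.

Definition convB (a b : B) : B :=
  (Fourier (diamond (Fourier_inv b^star) (Fourier_inv a^star)))^star.

Definition schur_product_on_dual : Prop :=
  forall a b : B, fa_ge0 a -> fa_ge0 b -> fa_ge0 (convB a b).

End FusionAlgebra.

(* [Fourier_inv] is the two-sided inverse of [Fourier]. *)
Lemma FourierK (R : realType) (n : nat) (B : fusion_algebra R n) :
  cancel (@Fourier R n B) (@Fourier_inv R n B).
Proof.
move=> u; apply/rowP => j; rewrite mxE /Fourier.
by rewrite coord_sum_free // (basis_free (fa_basisP B)).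
Qed.

Lemma Fourier_invK (R : realType) (n : nat) (B : fusion_algebra R n) :
  cancel (@Fourier_inv R n B) (@Fourier R n B).
Proof.
move=> a; rewrite /Fourier [RHS](coord_basis (fa_basisP B) (memvf a)).
by apply: eq_bigr => j _; rewrite mxE.
Qed.

(* Main.v *)
Require Import Defs.
From HB Require Import structures.
From mathcomp Require Import all_boot all_order all_algebra all_field.
From mathcomp Require Import complex.
From mathcomp Require Import boolp classical_sets reals.

(* The columns of [P] are common eigenvectors of all multiplications, so after
   rescaling they are the minimal idempotents e_j of B, with chi_k(e_j) =
   delta_jk, where chi_j(x_i) = Lambda i j.  Since tau(a^* b) is an inner
   product for which the x_i are orthonormal, chi_j(a^* ) is the conjugate of
   chi_j(a); hence a >= 0 iff chi_j(a) >= 0 for all j, and the coordinate of e_j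
   at x_i is tau(e_j) times the conjugate of Lambda i j.  As the convolution is
   bilinear and divides products of coordinates by d(x_i), the Schur property
   reduces to chi_l(convB e_j e_k) >= 0, which is the stated sum with its first
   two factors conjugated, up to tau(e_j) tau(e_k) > 0.  The conjugations are
   harmless: the fusion coefficients are real, so conjugation permutes the
   characters. *)

Import Order.TTheory GRing.Theory Num.Theory.
Local Open Scope complex_scope.
Local Open Scope ring_scope.

Lemma conjC_RtoC (R : realType) (r : R) : (r%:C)^* = r%:C.
Proof. exact: conjc_real. Qed.

(** * Star, trace inner product and coordinates in the basis *)

Section FusionBasis.
Variables (R : realType) (n : nat) (B : fusion_algebra R n).
Local Notation x := (fa_basis B).
Local Notation star := (@fa_star R n B).
Implicit Types a b : B.

Lemma star_antilinear (c : R[i]) a b :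
  star (c *: a + b) = c^* *: star a + star b.
Proof. exact: fa_star_antilinear. Qed.

Lemma fa_starZ (c : R[i]) a : star (c *: a) = c^* *: star a.
Proof.
have star0 : star 0 = 0.
  have := star_antilinear 1 0 0.
  rewrite scaler0 addr0 conjC1 scale1r => /(congr1 (fun b => b - star 0)).
  by rewrite subrr addrK => /esym.
by rewrite -[c *: a]addr0 star_antilinear star0 addr0.
Qed.

Lemma fa_starD a b : star (a + b) = star a + star b.
Proof. by rewrite -[a]scale1r star_antilinear conjC1 !scale1r. Qed.

Lemma fa_star_sum (I : Type) (s : seq I) (F : I -> B) :
  star (\sum_(i <- s) F i) = \sum_(i <- s) star (F i).
Proof.
elim/big_rec2: _ => [|i a b _ <-]; last exact: fa_starD.
by rewrite -(scale0r (0 : B)) fa_starZ conjC0 !scale0r.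
Qed.

Lemma fusion_coordE a : a = \sum_i coord x i a *: x`_i.
Proof. exact: coord_basis (fa_basisP B) (memvf a). Qed.

Lemma coord_fusion_sum (c : 'I_n.+1 -> R[i]) j :
  coord x j (\sum_i c i *: x`_i) = c j.
Proof. exact: coord_sum_free (basis_free (fa_basisP B)). Qed.

Lemma coord_fusion_basis (i j : 'I_n.+1) : coord x i x`_j = (j == i)%:R.
Proof. exact: coord_free (basis_free (fa_basisP B)). Qed.

Lemma fa_trace_is_scalar : scalar (@fa_trace R n B).
Proof. by move=> c a b; rewrite /fa_trace linearP. Qed.
HB.instance Definition _ :=
  GRing.isLinear.Build R[i] B R[i] *%R (@fa_trace R n B) fa_trace_is_scalar.

Lemma fa_traceZl c a b : fa_trace ((c *: a) * b) = c * fa_trace (a * b).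
Proof. by rewrite -scalerAl linearZ. Qed.

Lemma fa_traceZr c a b : fa_trace (a * (c *: b)) = c * fa_trace (a * b).
Proof. by rewrite -scalerAr linearZ. Qed.

(** The trace reads off the structure constant at the unit, which [fa_N_unit] prescribes. *)
Lemma fa_trace_basisM (i j : 'I_n.+1) :
  fa_trace (star x`_i * x`_j) = (i == j)%:R.
Proof.
rewrite fa_star_basis fa_basisM /fa_trace coord_fusion_sum fa_N_unit.
by rewrite (inj_eq (inv_inj (@fa_dualK _ _ B))); case: eqP.
Qed.

Lemma fa_traceE a b :
  fa_trace (star a * b) = \sum_i (coord x i a)^* * coord x i b.
Proof.
rewrite {1}[a]fusion_coordE {1}[b]fusion_coordE fa_star_sum mulr_suml.
rewrite linear_sum; apply: eq_bigr => i _.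
rewrite mulr_sumr linear_sum (bigD1 i) //= big1 => [|j neqji].
  by rewrite fa_starZ fa_traceZl fa_traceZr fa_trace_basisM
    eqxx mulr1 addr0.
rewrite fa_starZ fa_traceZl fa_traceZr fa_trace_basisM.
by rewrite eq_sym (negPf neqji) !mulr0.
Qed.

Lemma fa_trace_star_ge0 a : 0 <= fa_trace (star a * a).
Proof. by rewrite fa_traceE sumr_ge0 // => i _; rewrite mulrC mul_conjC_ge0. Qed.

Lemma fa_trace_star_eq0 a : fa_trace (star a * a) = 0 -> a = 0.
Proof.
rewrite fa_traceE => /eqP; rewrite psumr_eq0 => [/allP a0|i _]; last first.
  by rewrite mulrC mul_conjC_ge0.
rewrite [a]fusion_coordE big1 // => i _.
have /eqP/eqP := a0 i (mem_index_enum i).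
by rewrite mulf_eq0 conjC_eq0 orbb => /eqP ->; rewrite scale0r.
Qed.

Lemma coord_traceE a i : coord x i a = fa_trace (star x`_i * a).
Proof.
rewrite fa_traceE (bigD1 i) //= big1 => [|j neqji].
  by rewrite coord_fusion_basis eqxx conjC1 mul1r addr0.
rewrite coord_fusion_basis eq_sym (negPf neqji).
by rewrite conjC0 mul0r.
Qed.

Lemma opnorm_ge0 a : 0 <= opnorm a.
Proof.
rewrite /opnorm; set S := (X in sup X).
(* A set without supremum has [sup] equal to 0; otherwise [sup S] dominates a member, which is a
   square root. *)
have [hS|nS] := pselect (has_sup S); last by rewrite sup_out.
have [[y Sy] ubS] := hS.
apply: le_trans (ub_le_sup ubS Sy).
by case: Sy => v _ <-; apply: sqrtr_ge0.
Qed.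

Lemma fa_d_basis (i : 'I_n.+1) : fa_d x`_i = (opnorm x`_i)%:C.
Proof.
rewrite /fa_d (bigD1 i) //= big1 => [|j neqji].
  by rewrite coord_fusion_basis eqxx mul1r addr0.
rewrite coord_fusion_basis eq_sym (negPf neqji).
by rewrite mul0r.
Qed.

End FusionBasis.

(** * Characters as eigenvalues on common eigenvectors *)

Section Characters.
Variables (R : realType) (n : nat) (B : fusion_algebra R n).
Variables (Lambda P : 'M[R[i]]_n.+1).
Hypothesis mulC : fa_commutative B.
Hypothesis unitP : P \in unitmx.
Hypothesis diagP :
  forall i, invmx P *m fusion_mx B i *m P = diag_mx (row i Lambda).
Local Notation x := (fa_basis B).
Local Notation star := (@fa_star R n B).
Implicit Types a b : B.

Definition chi (j : 'I_n.+1) a : R[i] := \sum_i coord x i a * Lambda i j.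

Lemma chi_is_scalar j : scalar (chi j).
Proof.
move=> c a b; rewrite /chi mulr_sumr -big_split; apply: eq_bigr => i _ /=.
by rewrite linearP /= mulrDl mulrA.
Qed.
HB.instance Definition _ j :=
  GRing.isLinear.Build R[i] B R[i] *%R (chi j) (chi_is_scalar j).

Lemma chi_basis (i j : 'I_n.+1) : chi j x`_i = Lambda i j.
Proof.
rewrite /chi (bigD1 i) //= big1 => [|k neqki].
  by rewrite coord_fusion_basis eqxx mul1r addr0.
rewrite coord_fusion_basis eq_sym (negPf neqki).
by rewrite mul0r.
Qed.

(** Column [j] of [P] read as an element of the algebra, not yet normalised. *)
Definition eigvec j : B := \sum_k P k j *: x`_k.

Lemma fusion_eigP i s j :
  \sum_k (fa_N B i k s)%:C * P k j = P s j * Lambda i j.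
Proof.
have /matrixP/(_ s j) : fusion_mx B i *m P = P *m diag_mx (row i Lambda).
  by rewrite -diagP !mulmxA mulmxV // mul1mx.
rewrite mul_mx_diag !mxE => <-.
by apply: eq_bigr => k _; rewrite mxE.
Qed.

Lemma basis_mul_sum (i : 'I_n.+1) (c : 'I_n.+1 -> R[i]) :
  x`_i * (\sum_k c k *: x`_k)
    = \sum_s (\sum_k (fa_N B i k s)%:C * c k) *: x`_s.
Proof.
rewrite mulr_sumr (eq_bigr (fun k => \sum_s ((fa_N B i k s)%:C * c k) *: x`_s)).
  by rewrite exchange_big; apply: eq_bigr => s _; rewrite scaler_suml.
move=> k _; rewrite -scalerAr fa_basisM scaler_sumr.
by apply: eq_bigr => s _; rewrite scalerA mulrC.
Qed.

Lemma mul_eigvec a j : a * eigvec j = chi j a *: eigvec j.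
Proof.
rewrite {1}[a]fusion_coordE mulr_suml /chi scaler_suml.
apply: eq_bigr => i _; rewrite -scalerAl -scalerA; congr (_ *: _).
rewrite basis_mul_sum scaler_sumr; apply: eq_bigr => s _.
by rewrite fusion_eigP scalerA mulrC.
Qed.

Lemma eigvec_spanning a : exists c, a = \sum_j c j *: eigvec j.
Proof.
(* [P] changes eigenvector coordinates into basis coordinates, so its inverse gives the
   coefficients. *)
pose d := invmx P *m \col_k coord x k a; exists (fun j => d j 0).
transitivity (\sum_(k < n.+1) (\sum_j P k j * d j 0) *: x`_k).
  rewrite {1}[a]fusion_coordE; apply: eq_bigr => k _; congr (_ *: _).
  have /colP/(_ k) : \col_k coord x k a = P *m d by rewrite mulKVmx.
  by rewrite mxE => ->; rewrite mxE.
under eq_bigr do rewrite scaler_suml.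
rewrite exchange_big; apply: eq_bigr => j _; rewrite scaler_sumr.
by apply: eq_bigr => k _; rewrite scalerA mulrC.
Qed.

Lemma eigvec_free (c : 'I_n.+1 -> R[i]) :
  \sum_j c j *: eigvec j = 0 -> forall j, c j = 0.
Proof.
move=> c0.
have Pc0 : P *m (\col_j c j) = 0.
  apply/colP => k; rewrite !mxE -[RHS](linear0 (coord x k)) -c0.
  rewrite linear_sum; apply: eq_bigr => j _.
  by rewrite linearZ /= coord_fusion_sum mxE mulrC.
have /colP c0' : \col_j c j = 0 by rewrite -(mulKmx unitP (\col_j c j)) Pc0 mulmx0.
by move=> j; have := c0' j; rewrite !mxE.
Qed.

Lemma eigvec_neq0 j : eigvec j != 0.
Proof.
apply/eqP => p0.
have sum0 : \sum_k (k == j)%:R *: eigvec k = 0.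
  rewrite (bigD1 j) //= p0 scaler0 add0r big1 // => k /negPf ->.
  by rewrite scale0r.
by have /eqP := eigvec_free _ sum0 j; rewrite eqxx oner_eq0.
Qed.

(** Both sides are the eigenvalue of [a * b] on the nonzero vector [eigvec j]. *)
Lemma chiM j a b : chi j (a * b) = chi j a * chi j b.
Proof.
apply/eqP; rewrite -subr_eq0; have /negPf p0 := eigvec_neq0 j.
suff : (chi j (a * b) - chi j a * chi j b) *: eigvec j == 0.
  by rewrite scaler_eq0 p0 orbF.
rewrite scalerBl -mul_eigvec -mulrA mul_eigvec -scalerAr mul_eigvec scalerA.
by rewrite [chi j b * _]mulrC subrr.
Qed.

(** By commutativity the product of two eigenvectors is a multiple of each, and they are
    independent. *)
Lemma chi_eigvec_neq j k : j != k -> chi j (eigvec k) = 0.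
Proof.
move=> neqjk.
have : chi j (eigvec k) *: eigvec j - chi k (eigvec j) *: eigvec k = 0.
  by rewrite -!mul_eigvec mulC subrr.
(* Written as a sum over all indices, so that [eigvec_free] applies. *)
have E : chi j (eigvec k) *: eigvec j - chi k (eigvec j) *: eigvec k =
  \sum_l ((l == j)%:R * chi j (eigvec k) - (l == k)%:R * chi k (eigvec j)) *: eigvec l.
  rewrite (bigD1 j) //= (bigD1 k) 1?eq_sym //= big1 => [|l /andP[/negPf -> /negPf ->]].
    by rewrite !eqxx [k == j]eq_sym !(negPf neqjk) !mul0r !mul1r subr0 sub0r
      scaleNr addr0.
  by rewrite !mul0r subrr scale0r.
rewrite E => /eigvec_free/(_ j).
by rewrite eqxx (negPf neqjk) mul0r mul1r subr0.
Qed.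

(** The characters determine multiplication on eigenvectors, and 1 is a combination of these. *)
Lemma chi_inj a b : (forall j, chi j a = chi j b) -> a = b.
Proof.
move=> eqab; rewrite -[a]mulr1 -[b]mulr1; have [c ->] := eigvec_spanning 1.
rewrite !mulr_sumr; apply: eq_bigr => j _.
by rewrite -!scalerAr !mul_eigvec eqab.
Qed.

Lemma chi_eigvec_neq0 j : chi j (eigvec j) != 0.
Proof.
apply/eqP => pj0; have /eqP[] := eigvec_neq0 j.
apply: chi_inj => k; rewrite linear0.
by have [->//|/chi_eigvec_neq] := eqVneq k j.
Qed.

(* Locked so that unification does not expose the underlying scaling. *)
Definition idem j : B := locked ((chi j (eigvec j))^-1 *: eigvec j).

Lemma chi_idem j k : chi j (idem k) = (j == k)%:R.
Proof.
rewrite /idem -lock linearZ /=; case: eqVneq => [<-|/chi_eigvec_neq ->]; last by rewrite mulr0.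
by rewrite mulVf ?chi_eigvec_neq0.
Qed.

Lemma mul_idem a j : a * idem j = chi j a *: idem j.
Proof. by rewrite /idem -lock -scalerAr mul_eigvec !scalerA mulrC. Qed.

Lemma chi_idem_sum j (c : 'I_n.+1 -> R[i]) : chi j (\sum_k c k *: idem k) = c j.
Proof.
rewrite linear_sum (bigD1 j) //= big1 => [|k neqkj]; last first.
  by rewrite linearZ /= chi_idem eq_sym (negPf neqkj) mulr0.
by rewrite linearZ /= chi_idem eqxx mulr1 addr0.
Qed.

Lemma idem_sumE a : a = \sum_j chi j a *: idem j.
Proof. by apply: chi_inj => j; rewrite chi_idem_sum. Qed.

Lemma idem_neq0 j : idem j != 0.
Proof.
apply/eqP => e0; have := chi_idem j j.
by rewrite e0 linear0 eqxx => /esym/eqP; rewrite oner_eq0.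
Qed.

(* Multiplication by [star a] is adjoint to multiplication by [a], and
   [idem j] is a common eigenvector of both. *)
Lemma chi_star j a : chi j (star a) = (chi j a)^*.
Proof.
have tr_neq0 : fa_trace (star (idem j) * idem j) != 0.
  by apply/eqP => /fa_trace_star_eq0/eqP; rewrite (negPf (idem_neq0 j)).
apply: (mulIf tr_neq0).
transitivity (fa_trace (star (idem j) * (star a * idem j))).
  by rewrite (mul_idem (star a)) fa_traceZr.
by rewrite mulrA -fa_starM (mul_idem a) fa_starZ fa_traceZl.
Qed.

Lemma star_idem j : star (idem j) = idem j.
Proof.
by apply: chi_inj => k; rewrite chi_star chi_idem conjC_nat.
Qed.

(** * Positivity, traces of idempotents and conjugate characters *)

Lemma fa_ge0P a : fa_ge0 a <-> forall j, 0 <= chi j a.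
Proof.
split=> [[b ->] j|a_ge0]; first by rewrite chiM chi_star mulrC mul_conjC_ge0.
(* The square root of [a], taken character by character; its values are real, hence fixed by
   conjugation. *)
exists (\sum_j sqrtC (chi j a) *: idem j).
apply: chi_inj => j; rewrite chiM chi_star chi_idem_sum geC0_conj ?sqrtC_ge0 //.
by rewrite -expr2 sqrtCK.
Qed.

Lemma fa_ge0_idem j : fa_ge0 (idem j).
Proof. by apply/fa_ge0P => k; rewrite chi_idem ler0n. Qed.

(** A self-adjoint idempotent has trace equal to its squared norm. *)
Lemma trace_idem_gt0 j : 0 < fa_trace (idem j).
Proof.
have E : fa_trace (star (idem j) * idem j) = fa_trace (idem j).
  by rewrite star_idem mul_idem chi_idem eqxx scale1r.
rewrite lt_def -{2}E fa_trace_star_ge0 andbT -E.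
by apply/eqP => /fa_trace_star_eq0/eqP; rewrite (negPf (idem_neq0 j)).
Qed.

Lemma coord_idem (i j : 'I_n.+1) : coord x i (idem j) = (Lambda i j)^* * fa_trace (idem j).
Proof.
by rewrite coord_traceE mul_idem chi_star chi_basis linearZ.
Qed.

(* The fusion coefficients are real, so conjugating the coordinates of an
   eigenvector conjugates its eigenvalues. *)
Lemma conj_character j : exists j', forall i, Lambda i j' = (Lambda i j)^*.
Proof.
pose q : B := \sum_k (P k j)^* *: x`_k.
have mulq (i : 'I_n.+1) : x`_i * q = (Lambda i j)^* *: q.
  rewrite basis_mul_sum scaler_sumr; apply: eq_bigr => s _.
  rewrite scalerA -rmorphM /= mulrC -fusion_eigP rmorph_sum /=.
  by congr (_ *: _); apply: eq_bigr => k _; rewrite rmorphM /= conjC_RtoC.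
have q0 : q != 0.
  apply/eqP => q0; have /eqP[] := eigvec_neq0 j.
  rewrite /eigvec big1 // => k _.
  have := coord_fusion_sum _ _ B (fun k => (P k j)^*) k.
  by rewrite -/q q0 linear0 => /esym/eqP; rewrite conjC_eq0 => /eqP ->; rewrite scale0r.
(* A character not vanishing on [q] must take the eigenvalues of [q] as its values. *)
have [j' qj'] : exists j', chi j' q != 0.
  apply/existsP; apply: contraNT q0; rewrite negb_exists => /forallP q0.
  by apply/eqP/chi_inj => k; rewrite linear0; apply/eqP; rewrite -[_ == _]negbK.
exists j' => i; apply: (mulIf qj').
by rewrite -chi_basis -chiM mulq linearZ.
Qed.

(** * The convolution and the Schur criterion *)

Hypothesis Lambda0 : forall i : 'I_n.+1, Lambda i ord0 = fa_d x`_i.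

Lemma Lambda0_ge0 i : 0 <= Lambda i ord0.
Proof. by rewrite Lambda0 fa_d_basis lecR opnorm_ge0. Qed.

Lemma Lambda0_dual i : Lambda (fa_dual B i) ord0 = Lambda i ord0.
Proof.
by rewrite -chi_basis -fa_star_basis chi_star chi_basis geC0_conj ?Lambda0_ge0.
Qed.

Lemma coord_star a i : coord x i (star a) = (coord x (fa_dual B i) a)^*.
Proof.
rewrite {1}[a]fusion_coordE fa_star_sum.
under eq_bigr do rewrite fa_starZ fa_star_basis.
rewrite (reindex_inj (inv_inj (@fa_dualK _ _ B))) /=.
under eq_bigr do rewrite fa_dualK.
exact: coord_fusion_sum.
Qed.

(** The inner and outer stars cancel: indices are dualised and coordinates conjugated twice, while
    the weight is real and invariant under duality. *)
Lemma convBE a b :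
  convB a b = \sum_i (coord x i a * coord x i b / Lambda i ord0) *: x`_i.
Proof.
rewrite /convB /Fourier fa_star_sum (reindex_inj (inv_inj (@fa_dualK _ _ B))) /=.
apply: eq_bigr => i _; rewrite fa_starZ fa_star_basis fa_dualK; congr (_ *: _).
(* Only the diagonal term at [fa_dual B i] survives in the double sum. *)
rewrite /diamond summxE (bigD1 (fa_dual B i)) //= summxE.
rewrite (bigD1 (fa_dual B i)) //= big1 => [|k neqk]; last first.
  by rewrite !mxE [_ == k]eq_sym (negPf neqk) !mul0r mulr0.
rewrite big1 => [|k neqk]; last first.
  by rewrite summxE big1 // => l _; rewrite !mxE [_ == k]eq_sym (negPf neqk) andbF !mulr0.
rewrite !mxE !eqxx mul1r mulr1 !addr0 !coord_star fa_dualK -Lambda0 Lambda0_dual.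
rewrite !rmorphM /= !conjCK geC0_conj ?invr_ge0 ?Lambda0_ge0 //.
by rewrite [coord x i b * _]mulrC.
Qed.

Lemma chi_convB j a b :
  chi j (convB a b)
    = \sum_i coord x i a * coord x i b * Lambda i j / Lambda i ord0.
Proof.
rewrite convBE linear_sum; apply: eq_bigr => i _.
by rewrite linearZ /= chi_basis mulrAC.
Qed.

Lemma chi_convB_idem j k l :
  chi l (convB (idem j) (idem k))
    = fa_trace (idem j) * fa_trace (idem k)
      * \sum_i (Lambda i j)^* * (Lambda i k)^* * Lambda i l / Lambda i ord0.
Proof.
rewrite chi_convB mulr_sumr; apply: eq_bigr => i _.
by rewrite !coord_idem [X in X * _ / _]mulrACA [X in X * _ / _]mulrC !mulrA.
Qed.

(** Bilinear expansion in idempotents; for positive [a] and [b] the coefficients are nonnegative. *)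
Lemma chi_convB_sum a b l :
  chi l (convB a b)
    = \sum_j \sum_k chi j a * chi k b * chi l (convB (idem j) (idem k)).
Proof.
have E c i : coord x i c = \sum_j chi j c * coord x i (idem j).
  rewrite {1}[c]idem_sumE linear_sum.
  by apply: eq_bigr => j _; rewrite linearZ.
rewrite chi_convB.
under [RHS]eq_bigr do under eq_bigr do rewrite chi_convB mulr_sumr.
under [RHS]eq_bigr do rewrite exchange_big.
rewrite exchange_big; apply: eq_bigr => i _ /=.
rewrite (E a i) (E b i) big_distrlr /= 2!mulr_suml; apply: eq_bigr => j _.
rewrite 2!mulr_suml; apply: eq_bigr => k _.
by rewrite [X in X * _ / _]mulrACA !mulrA.
Qed.

Lemma schur_idemP :
  schur_product_on_dual B <->
  forall j k l, 0 <= \sum_i (Lambda i j)^* * (Lambda i k)^* * Lambda i l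
                        / Lambda i ord0.
Proof.
split=> [schur j k l|crit a b /fa_ge0P a_ge0 /fa_ge0P b_ge0].
  have /fa_ge0P/(_ l) := schur _ _ (fa_ge0_idem j) (fa_ge0_idem k).
  by rewrite chi_convB_idem pmulr_rge0 // mulr_gt0 ?trace_idem_gt0.
apply/fa_ge0P => l; rewrite chi_convB_sum.
apply: sumr_ge0 => j _; apply: sumr_ge0 => k _.
rewrite mulr_ge0 ?mulr_ge0 // chi_convB_idem.
by rewrite pmulr_rge0 // mulr_gt0 ?trace_idem_gt0.
Qed.

End Characters.

(* In [R[i]], [0 <= z] means that z is real and nonnegative. *)
Theorem corollary8p5 (R : realType) (n : nat) (B : fusion_algebra R n)
    (Lambda : 'M[R[i]]_n.+1) :
  fa_commutative B ->
  is_character_table B Lambda ->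
  (schur_product_on_dual B <->
   forall j1 j2 j3 : 'I_n.+1,
     0 <= \sum_(i < n.+1)
            Lambda i j1 * Lambda i j2 * Lambda i j3 / Lambda i ord0).
Proof.
move=> mulC [[P unitP diagP] Lambda0].
have conjL := conj_character _ _ _ _ _ unitP diagP.
have schurP := schur_idemP _ _ _ _ _ mulC unitP diagP Lambda0.
split=> [/schurP crit j k l|crit].
  (* At the conjugate characters [j'] and [k'] the two conjugations in the criterion undo
     themselves. *)
  have [j' Lj] := conjL j; have [k' Lk] := conjL k.
  by have := crit j' k' l; under eq_bigr do rewrite Lj Lk !conjCK.
apply/schurP => j k l; have [j' Lj] := conjL j; have [k' Lk] := conjL k.
by under eq_bigr do rewrite -Lj -Lk.
Qed.
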